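(* Let $\mathscr{X}=\{x\in\mathbb{R}^n: g_1(x)=0,\ldots,g_r(x)=0,\ g_{r+1}(x)\ge0,\ldots,g_s(x)\ge0\}$, with $g_1,\ldots,g_s\in\mathbb{R}[x_1,\ldots,x_n]$, be a complete semialgebraic subset of $\mathbb{R}^n$. Let $F:\mathbb{R}^n\to\mathbb{R}$ be a polynomial function, and assume that the infimum $f^*\in\mathbb{R}$ of the function $f:=F|_{\mathscr{X}}:\mathscr{X}\to\mathbb{R}$ is not attained. Then there exists a set of indices $I$ with $\{1,\ldots,r\}\subset I\subset\{1,\ldots,s\}$ such that \[ f^*\in\mathcal{B}_{F|_I}, \] where $F|_I$ denotes the restricted function $F|_{\mathbb{V}_{\mathbb{R}}(\boldsymbol g_I)}:\mathbb{V}_{\mathbb{R}}(\boldsymbol g_I)\to\mathbb{R}$.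
   Context: For $\{1,\ldots,r\}\subset I\subset\{1,\ldots,s\}$, $\mathbb{V}_{\mathbb{R}}(\boldsymbol g_I)$ is the common zero locus in $\mathbb{R}^n$ of the $g_i$, $i\in I$. The set $\mathscr{X}$ is called complete if, for every such $I$, the set $\mathbb{V}_{\mathbb{R}}(\boldsymbol g_I)$ is a smooth complete intersection of codimension $\#I$ (the Jacobian of $(g_i)_{i\in I}$ has full rank at all its points). For a polynomial function $h:X\to\mathbb{R}$ on a smooth affine variety $X\subset\mathbb{R}^n$, the bifurcation set $\mathcal{B}_h$ is the smallest subset $S\subset\mathbb{R}$ such that $h|_{h^{-1}(\mathbb{R}\setminus S)}:h^{-1}(\mathbb{R}\setminus S)\to\mathbb{R}\setminus S$ is a (locally trivial) $\mathcal{C}^\infty$-fibration, i.e. every point of $\mathbb{R}\setminus S$ has an open neighbourhood $U$ such that $h^{-1}(U)$ is diffeomorphic to $h^{-1}(z)\times U$ ($z\in U$) compatibly with the projections to $U$ (empty fibres are allowed). It is a finite set. *)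

(* Defs.v *)
(* MathComp + MathComp-Analysis, over an arbitrary R : realType.
   mpoly is required but not imported: its notations clash with those of
   MathComp-Analysis. *)
From HB Require Import structures.
From mathcomp Require Import all_boot all_order all_algebra.
From mathcomp Require mpoly.
From mathcomp Require Import all_classical all_reals all_analysis.

Set Implicit Arguments.
Unset Strict Implicit.
Unset Printing Implicit Defensive.

Import Order.TTheory GRing.Theory Num.Theory.
Import numFieldNormedType.Exports.

Local Open Scope classical_set_scope.
Local Open Scope ring_scope.

(* C^k on an open set O, through iterated directional derivatives in all
   directions.  Only used for V = R^n and V = R^n * R, where it is the usual
   notion because V is finite dimensional. *)
Fixpoint is_Ck (R : realType) (V W : normedModType R) (k : nat)
    (O : set V) (f : V -> W) : Prop :=
  (forall x, O x -> {for x, continuous f}) /\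
  match k with
  | 0 => True
  | k'.+1 => forall v : V,
      (forall x, O x -> derivable f x v) /\ is_Ck k' O ('D_v f)
  end.

(* Smoothness on an arbitrary subset A of V: local extension to C^oo maps on
   open sets of V.  For A an embedded submanifold, this is smoothness for the
   manifold structure of A.  The values of f outside A are irrelevant. *)
Definition smooth_on (R : realType) (V W : normedModType R)
    (A : set V) (f : V -> W) : Prop :=
  forall x, A x -> exists O : set V, exists g : V -> W,
    [/\ open O, O x, (forall k, is_Ck k O g)
      & forall y, A y -> O y -> g y = f y].

Definition poly_fun (R : realType) (n : nat) (p : mpoly.mpoly n R)
    (x : 'rV[R]_n) : R :=
  mpoly.meval (fun i => x ord0 i) p.

(* The part of X above U is diffeomorphic, over U, to h^-1(z) * U for some
   z in U; Phi and Psi are the inverse diffeomorphisms.  Only the restriction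
   of h to X matters, and all fibres may be empty. *)
Definition trivial_over (R : realType) (n : nat) (X : set 'rV[R]_n)
    (h : 'rV[R]_n -> R) (U : set R) : Prop :=
  exists2 z : R, U z &
  exists Phi : 'rV[R]_n * R -> 'rV[R]_n,
  exists Psi : 'rV[R]_n -> 'rV[R]_n * R,
  let E := X `&` h @^-1` U in
  let P := (X `&` h @^-1` [set z]) `*` U in
  [/\ smooth_on P Phi /\ smooth_on E Psi,
      (forall p, P p -> E (Phi p)) /\ (forall x, E x -> P (Psi x)),
      (forall p, P p -> Psi (Phi p) = p) /\ (forall x, E x -> Phi (Psi x) = x)
    & forall p, P p -> h (Phi p) = p.2].

Definition fibration_outside (R : realType) (n : nat) (X : set 'rV[R]_n)
    (h : 'rV[R]_n -> R) (S : set R) : Prop :=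
  forall t, ~ S t ->
    exists U : set R, [/\ open U, U t, U `<=` ~` S & trivial_over X h U].

Definition bifurcation_set (R : realType) (n : nat) (X : set 'rV[R]_n)
    (h : 'rV[R]_n -> R) : set R :=
  smallest (fibration_outside X h) set0.

(* [smallest] is an intersection; the intersection has the defining property,
   hence is a genuine minimum. *)
Lemma bifurcation_setP (R : realType) (n : nat) (X : set 'rV[R]_n)
    (h : 'rV[R]_n -> R) :
  fibration_outside X h (bifurcation_set X h) /\
  (forall S, fibration_outside X h S -> bifurcation_set X h `<=` S).
Proof.
have sub S : fibration_outside X h S -> bifurcation_set X h `<=` S.
  by move=> fS; apply: smallest_sub.
split=> // t /existsNP[S /not_implyP[[fS _] nSt]].
have [U [oU Ut US tU]] := fS t nSt.
by exists U; split=> // u Uu /(sub _ fS); exact: US.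
Qed.

(* The equations are those of index < r, the inequalities those of index >= r
   (indices start at 0). *)
Definition semialg_set (R : realType) (n r s : nat)
    (g : 'I_s -> mpoly.mpoly n R) : set 'rV[R]_n :=
  [set x | forall i : 'I_s,
     if (i < r)%N then poly_fun (g i) x = 0 else 0 <= poly_fun (g i) x].

Definition zero_locus (R : realType) (n s : nat)
    (g : 'I_s -> mpoly.mpoly n R) (I : {set 'I_s}) : set 'rV[R]_n :=
  [set x | forall i, i \in I -> poly_fun (g i) x = 0].

Definition jacobian_at (R : realType) (n s : nat)
    (g : 'I_s -> mpoly.mpoly n R) (I : {set 'I_s}) (x : 'rV[R]_n) :
    'M[R]_(#|I|, n) :=
  \matrix_(k < #|I|, j < n) poly_fun (mpoly.mderiv j (g (enum_val k))) x.

(* Full rank means rank #|I|; in particular the empty set qualifies, and it is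
   the only possibility when #|I| > n. *)
Definition smooth_complete_intersection (R : realType) (n s : nat)
    (g : 'I_s -> mpoly.mpoly n R) (I : {set 'I_s}) : Prop :=
  forall x, zero_locus g I x -> \rank (jacobian_at g I x) = #|I|.

Definition complete (R : realType) (n r s : nat)
    (g : 'I_s -> mpoly.mpoly n R) : Prop :=
  forall I : {set 'I_s}, (forall i : 'I_s, (i < r)%N -> i \in I) ->
    smooth_complete_intersection g I.

(* Main.v *)
Require Import Defs.
From HB Require Import structures.
From mathcomp Require Import all_boot all_order all_algebra.
From mathcomp Require mpoly.
From mathcomp Require Import all_classical all_reals all_analysis.

(** The argument is a descent from stratum to stratum along the trivialisations.
    Suppose that [fstar] avoids the bifurcation sets of all the restrictions of
    [F] to the loci [zero_locus g I], where [I] ranges over the sets containing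
    the indices of the equations.  Take [x] in the semialgebraic set and in such a
    locus, with [F x] slightly above [fstar].  Triviality over a neighbourhood
    of [fstar] gives a path in the locus that starts at [x] and along which [F]
    decreases from [F x] to [fstar] at unit speed ([trivial_over_lift]).  The
    path cannot stay in the semialgebraic set, since [fstar] would be attained
    at its end.  So some inequality is violated on the way, and by the
    intermediate value theorem there is a point of the path still in the
    semialgebraic set at which a further [g j] vanishes ([boundary_crossing]).
    The value of [F] there is no farther from [fstar], and the point lies in the
    smaller locus [zero_locus g (j |: I)].

    Read contrapositively, this is an induction on the number of indices outside
    [I]: if, on each smaller locus, [F] stays away from [fstar] on the
    semialgebraic set, then so it does on the locus of [I] ([stratum_gap]).
    When [I] contains all the indices there is nothing to violate.  For the
    smallest [I], which consists of the equations only, the locus contains the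
    whole semialgebraic set, and the gap contradicts the definition of [fstar]
    as an infimum. *)

Import Order.TTheory GRing.Theory Num.Theory.
Import numFieldNormedType.Exports.

Local Open Scope classical_set_scope.
Local Open Scope ring_scope.

Lemma poly_fun_continuous (R : realType) (n : nat) (p : mpoly.mpoly n R) :
  continuous (poly_fun p).
Proof.
have -> : poly_fun p = (fun x : 'rV[R]_n => \sum_(m <- mpoly.msupp p)
    mpoly.mcoeff m p * \prod_i x ord0 i ^+ mpoly.fun_of_multinom m i).
  by apply/funext => x; exact: mpoly.mevalE.
move=> /= x.
apply: (@cvg_big _ _ _ _ _ _ _ (nbhs (x : 'rV[R]_n))) => [|m _].
  exact: add_continuous.
apply: cvgM; first exact: cvg_cst.
apply: cvg_big => [|i _]; first exact: mul_continuous.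
apply: (@cvg_comp _ _ _ (fun y : 'rV[R]_n => y ord0 i) (fun a => a ^+ _)).
  exact: coord_continuous.
exact: exprn_continuous.
Qed.

(** The section of [h] through [x] is the horizontal line through [x] in the
    product structure of the trivialisation.  It is continuous because [Phi]
    agrees with a continuous map near each point of the product, and a
    horizontal line over an open set stays in the product. *)
Lemma trivial_over_lift (R : realType) (n : nat) (X : set 'rV[R]_n)
    (h : 'rV[R]_n -> R) (U : set R) (x : 'rV[R]_n) :
  open U -> trivial_over X h U -> X x -> U (h x) ->
  exists gamma : R -> 'rV[R]_n, gamma (h x) = x /\
    forall u, U u ->
      [/\ X (gamma u), h (gamma u) = u & {for u, continuous gamma}].
Proof.
move=> oU [z Uz [Phi [Psi /= [[sPhi _] [PhiE PsiP] [_ PsiK] hPhi]]]] Xx Uhx.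
have Ex : (X `&` h @^-1` U) x by [].
set y := (Psi x).1.
have Fy : (X `&` h @^-1` [set z]) y by have [] := PsiP x Ex.
have Psix2 : (Psi x).2 = h x by rewrite -(hPhi _ (PsiP x Ex)) PsiK.
have Pu u : U u -> ((X `&` h @^-1` [set z]) `*` U) (y, u) by [].
exists (fun u => Phi (y, u)); split.
  by rewrite -Psix2 -surjective_pairing PsiK.
move=> u Uu; split; [by have [] := PhiE _ (Pu u Uu)|exact: hPhi (Pu u Uu)|].
have [W [G [oW Wu smG GPhi]]] := sPhi _ (Pu u Uu).
have pair_cont : {for u, continuous (fun v : R => (y, v))}.
  exact: (cvg_pair (cvg_cst _) cvg_id).
have Gcont : {for u, continuous (fun v => G (y, v))}.
  by apply: continuous_comp pair_cont _; have [+ _] := smG 0%N; apply.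
have GE : \forall v \near u, G (y, v) = Phi (y, v).
  near=> v; apply: GPhi.
    by apply: Pu; near: v; exact: open_nbhs_nbhs.
  by near: v; apply: pair_cont; exact: open_nbhs_nbhs.
rewrite /prop_for /continuous_at -(nbhs_singleton GE).
exact: cvg_trans (near_eq_cvg GE) Gcont.
Unshelve. all: by end_near.
Qed.

(** The intermediate value theorem for the minimum of the functions, which is
    nonnegative exactly where they all are. *)
Lemma boundary_crossing (R : realType) (J : finType) (P : pred J) (f : J -> R -> R)
    (a b : R) :
  a <= b -> (forall j u, P j -> u \in `[a, b] -> {for u, continuous (f j)}) ->
  (forall j, P j -> 0 <= f j b) -> ~ (forall j, P j -> 0 <= f j a) ->
  exists2 u, u \in `[a, b] &
    (forall j, P j -> 0 <= f j u) /\ exists2 j, P j & f j u = 0.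
Proof.
move=> ab cf fb nfa.
(* The positive default value makes the minimum vanish only where some f j
   does, whatever P is. *)
pose m u := \big[Num.min/1]_(j | P j) f j u.
have cm : {within `[a, b], continuous m}.
  apply: continuous_in_subspaceT => u uab; apply: cvg_big => [|j Pj].
    by move=> p; apply: continuous_min; [exact: cvg_fst|exact: cvg_snd].
  by apply: cf => //; rewrite inE in uab.
have mb : 0 <= m b by apply: le_bigmin.
have ma : m a < 0.
  by rewrite ltNge; apply/negP => /bigmin_geP[_].
have [|u uab mu0] := IVT ab cm (v := 0).
  by rewrite ge_min le_max (ltW ma) mb orbT.
exists u => //; split; first by have /bigmin_geP[] : 0 <= m u by rewrite mu0.
have /bigmin_leP[|[j Pj fj]] : m u <= 0 by rewrite mu0.
  by rewrite ler10.
exists j => //; apply/eqP; rewrite eq_le fj /=.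
by have /bigmin_geP[_ ->] : 0 <= m u by rewrite mu0.
Qed.

(** The gap on the locus of [I] is the least of the gaps on the loci of the sets
    [j |: I] and of the radius of a ball around [c] over which [h] is trivial.
    From a point below this gap, the lift of the segment down to [c] exists, and
    it either reaches the value [c] in the semialgebraic set or crosses a locus
    of [j |: I] below the gap there. *)
Lemma stratum_gap (R : realType) (n r s : nat) (g : 'I_s -> mpoly.mpoly n R)
    (h : 'rV[R]_n -> R) (c : R) (I : {set 'I_s}) :
  (forall I : {set 'I_s}, (forall i : 'I_s, (i < r)%N -> i \in I) ->
     ~ bifurcation_set (zero_locus g I) h c) ->
  (forall x, semialg_set r g x -> c < h x) ->
  (forall i : 'I_s, (i < r)%N -> i \in I) ->
  exists2 e : R, 0 < e &
    forall x, semialg_set r g x -> zero_locus g I x -> c + e <= h x.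
Proof.
move=> regular above; have [k] := ubnP #|~: I|%SET.
elim: k I => // k IHk I; rewrite ltnS => cardI rI.
have [e e_gt0 gap] : exists2 e : 'I_s -> R, forall j, 0 < e j &
    forall j, j \notin I -> forall x, semialg_set r g x ->
      zero_locus g (j |: I)%SET x -> c + e j <= h x.
  suff /choice[e eP] : forall j, exists e : R, 0 < e /\
      (j \notin I -> forall x, semialg_set r g x ->
       zero_locus g (j |: I)%SET x -> c + e <= h x).
    by exists e => j; have [] := eP j.
  move=> j; have [jI|jNI] := boolP (j \in I); first by exists 1.
  have [||e e_gt0 eP] := IHk (j |: I)%SET; last by exists e.
    apply: leq_trans cardI; apply: proper_card.
    apply/properP; split; first by rewrite finset.setCS finset.subsetUr.
    by exists j; rewrite !inE ?jNI ?eqxx.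
  by move=> i ir; rewrite !inE rI ?orbT.
have [fib _] := bifurcation_setP (zero_locus g I) h.
have [U [oU Uc _ trivU]] := fib c (regular I rI).
have [d /= d_gt0 dU] : nbhs_ball c U by apply/nbhs_ballP/open_nbhs_nbhs.
exists (\big[Num.min/d]_(j | j \notin I) e j); first exact: lt_bigmin.
move=> x Sx Zx; rewrite leNgt; apply/negP => hx.
have hx_d : h x < c + d.
  by apply: lt_le_trans hx _; rewrite lerD2l bigmin_le_id.
have cU u : u \in `[c, h x] -> U u.
  rewrite in_itv /= => /andP[cu uhx]; apply: dU.
  rewrite /ball /= distrC ger0_norm ?subr_ge0// ltrBlDl.
  exact: le_lt_trans hx_d.
have chx := ltW (above _ Sx).
have [|gamma [gammax lift]] := trivial_over_lift _ _ _ _ _ _ oU trivU Zx.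
  by apply: cU; rewrite in_itv /= chx lexx.
have Sgamma u : U u -> (forall j, j \notin I -> 0 <= poly_fun (g j) (gamma u)) ->
    semialg_set r g (gamma u).
  move=> Uu ge0 i; have [Zu _ _] := lift u Uu; case: ifPn => ir.
    exact/Zu/rI.
  by have [iI|/ge0//] := boolP (i \in I); rewrite Zu.
have [|||u ucx [ge0 [j jNI gj0]]] := boundary_crossing R 'I_s [pred j | j \notin I]
    (fun j u => poly_fun (g j) (gamma u)) c (h x) chx.
- move=> j u _ /cU/lift[_ _ cu]; apply: continuous_comp cu _.
  exact: poly_fun_continuous.
- move=> j /= jNI; rewrite gammax; have := Sx j.
  by case: ifPn => // /rI; rewrite (negPf jNI).
- move=> /(Sgamma c Uc)/above; have [_ -> _] := lift c Uc.
  by rewrite ltxx.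
have Uu := cU _ ucx; have [Zu hu _] := lift u Uu.
have Zju : zero_locus g (j |: I)%SET (gamma u).
  by move=> i; rewrite !inE => /predU1P[->//|]; exact: Zu.
have := gap j jNI _ (Sgamma u Uu ge0) Zju.
rewrite hu leNgt => /negP; apply.
move: ucx; rewrite in_itv /= => /andP[_ /le_lt_trans]; apply.
by apply: lt_le_trans hx _; rewrite lerD2l bigmin_le_cond.
Qed.

Theorem theorem8 (R : realType) (n r s : nat) (hrs : (r <= s)%N)
    (g : 'I_s -> mpoly.mpoly n R) (hcomplete : complete r g)
    (F : mpoly.mpoly n R) (fstar : R)
    (hinf : has_inf (poly_fun F @` semialg_set r g))
    (hfstar : fstar = inf (poly_fun F @` semialg_set r g))
    (hnot_attained :
       ~ (exists2 x, semialg_set r g x & poly_fun F x = fstar)) :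
  exists I : {set 'I_s},
    (forall i : 'I_s, (i < r)%N -> i \in I) /\
    bifurcation_set (zero_locus g I) (poly_fun F) fstar.
Proof.
apply: contrapT => noI.
have [e e_gt0 gap] : exists2 e : R, 0 < e &
    forall x, semialg_set r g x -> fstar + e <= poly_fun F x.
  have [||i|e e_gt0 gap] := stratum_gap R n r s g (poly_fun F) fstar
      [set i : 'I_s | (i < r)%N]%SET.
  - by move=> I rI bI; apply: noI; exists I.
  - move=> x Sx; rewrite lt_neqAle; apply/andP; split.
      by apply/eqP => Fx; apply: hnot_attained; exists x.
    by rewrite hfstar; apply: ge_inf; [case: hinf|exists x].
  - by rewrite inE.
  exists e => // x Sx; apply: gap => // i; rewrite inE => ir.
  by have := Sx i; rewrite ir.
have : fstar + e <= fstar.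
  rewrite [leRHS]hfstar; apply: lb_le_inf; first by case: hinf.
  by move=> _ [x Sx <-]; exact: gap.
by rewrite gerDl leNgt e_gt0.
Qed.
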